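(* There exists an absolute constant $C > 0$ such that for every integer $H \geq 3$, $$H+1 \leq \nu(H) \leq C H^3.$$
   Context: For a subset $A \subseteq \mathbb{Z}$ and a positive integer $h$, the $h$-fold iterated sumset is $hA:=\{a_1+\cdots+a_h : a_1,\ldots,a_h \in A\}$ (repetitions allowed), and $|X|$ denotes the cardinality of a finite set $X$. For integers $a \le b$, $[a,b]:=\{a,a+1,\ldots,b\}$. For a positive integer $H$, $\nu(H)$ denotes the smallest natural number $N$ such that for each choice of signs $\epsilon_1, \ldots, \epsilon_H \in \{-,+\}$, there are sets $A,B \subseteq [0,N]$ such that $|hA|-|hB|$ has the same sign as $\epsilon_h$ for each $1 \leq h \leq H$ (that is, $|hA|-|hB|>0$ if $\epsilon_h = +$ and $|hA|-|hB|<0$ if $\epsilon_h=-$). Such an $N$ exists for every $H$. *)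

(* Defs.v *)
From mathcomp Require Import all_boot all_order all_algebra finmap.
From mathcomp Require Import reals.

Set Implicit Arguments.
Unset Strict Implicit.
Unset Printing Implicit Defensive.

Import Order.TTheory GRing.Theory Num.Theory.

Local Open Scope fset_scope.
Local Open Scope ring_scope.

(* The coercion of [A] to a type makes [f] range over the h-tuples of elements
   of [A]; repetitions are allowed. *)
Definition sumset (h : nat) (A : {fset int}) : {fset int} :=
  [fset \sum_(i < h) val (f i) | f : {ffun 'I_h -> A} in predT].

Definition in_interval (a b : int) (A : {fset int}) : Prop :=
  forall x, x \in A -> a <= x <= b.

Definition has_sign (e : bool) (x : int) : Prop :=
  if e then 0 < x else x < 0.

(* Only the values [eps 1, ..., eps H] matter; [true] stands for the sign +. *)
Definition all_signs_realized (H N : nat) : Prop :=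
  forall eps : nat -> bool,
  exists A B : {fset int},
    [/\ in_interval 0 N%:Z A,
        in_interval 0 N%:Z B
      & forall h : nat, (1 <= h <= H)%N ->
          has_sign (eps h) (#|` sumset h A|%:Z - #|` sumset h B|%:Z)].

Definition is_nu (H N : nat) : Prop :=
  all_signs_realized H N /\
  forall M : nat, all_signs_realized H M -> (N <= M)%N.

Lemma is_nu_unique (H N N' : nat) : is_nu H N -> is_nu H N' -> N = N'.
Proof.
move=> [hN minN] [hN' minN']; apply/eqP.
by rewrite eqn_leq minN // minN'.
Qed.

Lemma sumsetP (h : nat) (A : {fset int}) (x : int) :
  reflect (exists2 a : 'I_h -> int, (forall i, a i \in A) & x = \sum_i a i)
          (x \in sumset h A).
Proof.
apply: (iffP (imfsetP _ _ _ _)) => /= [[f _ ->]|[a aA ->]].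
  by exists (fun i => val (f i)) => // i; apply: valP.
exists [ffun i => [` aA i]]; first by rewrite inE.
by apply: eq_bigr => i _; rewrite ffunE.
Qed.

(* Main.v *)
Require Import Defs.
From mathcomp Require Import all_boot all_order all_algebra finmap.
From mathcomp Require Import reals.
From mathcomp Require Import boolp zify ring.

(** Upper bound.  Place far apart the triples {0, d, 2j+2} (j < H), with d = j or
    d = j+1, above {0, 1} and below a long interval.  The h-fold sumset of this
    set is [0, h], the triples thickened by [0, h-1], and a full interval.  A
    thickened triple has h + min(h, d) + min(h, 2j+2-d) elements, which depends
    on the choice of d only for h = j+1: hence the H signs can be prescribed
    independently, inside [0, 12 H^2].

    Lower bound.  If 0 and a belong to X and X is contained in [0, a], then
    |hX| is affine in h from h = a + 2 - |X| on (Granville and Walker).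
    Alternating signs at h = 1, 2 force |A| and |B| to be at least 4; if A and B
    lie in [0, H], then |hA| - |hB| is affine on {H-2, H-1, H} and cannot
    alternate there. *)

Set Implicit Arguments.
Unset Strict Implicit.
Unset Printing Implicit Defensive.

Import Order.TTheory GRing.Theory Num.Theory.

Local Open Scope ring_scope.

(** * Sumsets as sums of finite sequences *)

Lemma sumset_seqP (h : nat) (A : {fset int}) (x : int) :
  reflect (exists s : seq int,
             [/\ size s = h, {subset s <= A} & x = \sum_(y <- s) y])
          (x \in sumset h A).
Proof.
apply: (iffP (sumsetP _ _ _)) => [[a aA ->]|[s [sz sA ->]]].
  exists [seq a i | i <- enum 'I_h]; split.
  - by rewrite size_map size_enum_ord.
  - by move=> _ /mapP[i _ ->].
  - by rewrite big_map big_enum.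
exists (fun i : 'I_h => nth 0 s i); last by rewrite (big_nth 0) big_mkord sz.
by move=> i; apply/sA/mem_nth; rewrite sz.
Qed.

Lemma mem_sumset_seq (A : {fset int}) (s : seq int) :
  {subset s <= A} -> \sum_(y <- s) y \in sumset (size s) A.
Proof. by move=> sA; apply/sumset_seqP; exists s. Qed.

Lemma sumsetD (A : {fset int}) (m n : nat) (x y : int) :
  x \in sumset m A -> y \in sumset n A -> x + y \in sumset (m + n) A.
Proof.
move=> /sumset_seqP[s [<- sA ->]] /sumset_seqP[t [<- tA ->]].
rewrite -big_cat -size_cat; apply: mem_sumset_seq => z.
by rewrite mem_cat => /orP[/sA|/tA].
Qed.

Lemma mem_sumset0 (A : {fset int}) : 0 \in sumset 0 A.
Proof. by apply/sumset_seqP; exists [::]; rewrite big_nil. Qed.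

Lemma mem_sumset1 (A : {fset int}) (x : int) : x \in A -> x \in sumset 1 A.
Proof.
move=> xA; apply/sumset_seqP; exists [:: x]; rewrite big_seq1.
by split=> // z; rewrite inE => /eqP->.
Qed.

Lemma sumset_mulrn (A : {fset int}) (a : int) (n : nat) :
  a \in A -> a *+ n \in sumset n A.
Proof.
move=> aA; elim: n => [|n IH]; first exact: mem_sumset0.
by rewrite mulrS -add1n; apply: sumsetD => //; apply: mem_sumset1.
Qed.

Lemma sumset_le (A : {fset int}) (m n : nat) (x : int) :
  0 \in A -> (m <= n)%N -> x \in sumset m A -> x \in sumset n A.
Proof.
move=> A0 mn xm; rewrite -(subnKC mn) -(addr0 x); apply: sumsetD => //.
by rewrite -(mul0rn _ (n - m)); apply: sumset_mulrn.
Qed.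

(** * Bounds on sums, and residues modulo [a] *)

Lemma sum_open_interval (a : int) (s : seq int) :
  {in s, forall x, 0 < x < a} -> (0 < size s)%N ->
  0 < \sum_(x <- s) x < a * (size s)%:Z.
Proof.
elim: s => [//|x s IH] xs _; rewrite big_cons /=.
have x0 : 0 < x < a by apply: xs; rewrite mem_head.
case: s IH xs => [_ _|y s IH xs]; first by rewrite big_nil /=; lia.
have /IH -/(_ isT) : {in y :: s, forall z, 0 < z < a}.
  by move=> z zs; apply: xs; rewrite inE zs orbT.
set t := \sum_(_ <- _) _ => /=; lia.
Qed.

Lemma take_take_drop (T : Type) (i j : nat) (s : seq T) :
  (i <= j)%N -> take j s = take i s ++ take (j - i) (drop i s).
Proof. by move=> ij; rewrite -{1}(subnKC ij) takeD. Qed.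

Lemma size_uniq_interval (a : nat) (s : seq int) :
  uniq s -> {in s, forall x, 0 <= x < a%:Z} -> (size s <= a)%N.
Proof.
move=> us sa.
have -> : a = size [seq Posz i | i <- iota 0 a] by rewrite size_map size_iota.
apply: uniq_leq_size => // x /sa xa; apply/mapP; exists `|x|%N; last lia.
by rewrite mem_iota; lia.
Qed.

Lemma eqmod_shift (a : nat) (x y : int) :
  (x %% a%:Z = y %% a%:Z)%Z ->
  exists k : nat, x = y + a%:Z *+ k \/ y = x + a%:Z *+ k.
Proof.
move/eqP; rewrite eqz_mod_dvd => /dvdzP[q qE].
exists `|q|%N; rewrite -mulr_natr natz; case: (leP 0 q) => q0.
  by left; rewrite gez0_abs // mulrC -qE addrC subrK.
by right; rewrite ltz0_abs // mulrN mulrC -qE opprB addrC subrK.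
Qed.

(** * Irreducible sequences and the residues of their partial sums *)

Definition psum (s : seq int) (i : nat) : int := \sum_(x <- take i s) x.

Lemma psum0 (s : seq int) : psum s 0 = 0.
Proof. by rewrite /psum take0 big_nil. Qed.

Lemma sum_psum (s : seq int) (i : nat) :
  \sum_(x <- s) x = psum s i + \sum_(x <- drop i s) x.
Proof. by rewrite -{1}(cat_take_drop i s) big_cat. Qed.

Lemma psum_subset (X : {fset int}) (s : seq int) (i : nat) :
  {subset s <= X} -> (i <= size s)%N -> psum s i \in sumset i X.
Proof.
move=> sX ile; have {2}<- : size (take i s) = i by rewrite size_takel.
by apply: mem_sumset_seq => x /mem_take/sX.
Qed.

Lemma psum_drop (X : {fset int}) (s : seq int) (i : nat) :
  {subset s <= X} -> \sum_(x <- s) x - psum s i \in sumset (size s - i) X.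
Proof.
move=> sX; rewrite (sum_psum s i) [X in X - _]addrC addrK -size_drop.
by apply: mem_sumset_seq => x /mem_drop/sX.
Qed.

Lemma psum_bounds (a : int) (s : seq int) (i j : nat) :
  {in s, forall x, 0 < x < a} -> (i < j <= size s)%N ->
  0 < psum s j - psum s i < a * (j - i)%N%:Z.
Proof.
move=> sa /andP[ij js].
rewrite /psum (take_take_drop s (ltnW ij)) big_cat /= [X in X - _]addrC addrK.
have sz : size (take (j - i) (drop i s)) = (j - i)%N.
  by rewrite size_takel // size_drop leq_sub2r.
rewrite -[X in _ * X%:Z]sz; apply: sum_open_interval; last by rewrite sz subn_gt0.
by move=> x /mem_take/mem_drop/sa.
Qed.

(* No way of writing the sum of [s] with at most [size s] terms from [X]
   uses copies of [a], or fewer terms than [s]. *)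
Definition irreducible (a : nat) (X : {fset int}) (s : seq int) : Prop :=
  {subset s <= X} /\
  forall (q k : nat) (y : int), y \in sumset q X ->
    \sum_(x <- s) x = y + a%:Z *+ k -> (q + k <= size s)%N -> q = size s.

(** A shorter rewriting of a block of [s], put between the untouched ends, would rewrite the whole
    sum. *)
Lemma irreducible_block (a : nat) (X : {fset int}) (s : seq int)
    (i j q k : nat) (y : int) :
  irreducible a X s -> (i <= j <= size s)%N -> y \in sumset q X ->
  psum s j = psum s i + y + a%:Z *+ k -> (q + k <= j - i)%N -> q = (j - i)%N.
Proof.
move=> [sX irr] /andP[ij js] yX E qk.
have iX : psum s i \in sumset i X by apply: psum_subset => //; lia.
have := irr _ k _ (sumsetD (sumsetD iX yX) (psum_drop j sX)).
by rewrite E; lia.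
Qed.

(** A term 0 could be dropped and a term [a] counted as a copy of [a]: both rewrite a one-term block
    with q = 0. *)
Lemma irreducible_interior (a : nat) (X : {fset int}) (s : seq int) :
  in_interval 0 a X -> irreducible a X s -> {in s, forall x, 0 < x < a%:Z}.
Proof.
move=> Xa irr x xs; have [sX _] := irr.
have := Xa _ (sX _ xs); have ix : (index x s < size s)%N by rewrite index_mem.
have E : psum s (index x s).+1 = psum s (index x s) + x.
  by rewrite /psum (take_nth 0) // nth_index // -cats1 big_cat big_seq1.
have nE k : x = a%:Z *+ k -> (k <= 1)%N -> False.
  move=> xk k1.
  have E' : psum s (index x s).+1 = psum s (index x s) + 0 + a%:Z *+ k.
    by rewrite E addr0 -xk.
  have := irreducible_block irr _ (mem_sumset0 X) E'; lia.
have := nE 0; have := nE 1; lia.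
Qed.

(** A congruence would make the block between the two partial sums a multiple k a with k < j - i,
    replaceable by k copies of [a]. *)
Lemma irreducible_psum_neq (a : nat) (X : {fset int}) (s : seq int) (i j : nat) :
  in_interval 0 a X -> irreducible a X s -> (i < j <= size s)%N ->
  (psum s i %% a%:Z)%Z != (psum s j %% a%:Z)%Z.
Proof.
move=> Xa irr ijs; apply/eqP => /eqmod_shift[k].
have := psum_bounds (irreducible_interior Xa irr) ijs.
case/andP=> lt0 ltj [] E; first by move: lt0; rewrite E; nia.
have kl : (k < j - i)%N by nia.
have E' : psum s j = psum s i + 0 + a%:Z *+ k by rewrite addr0.
have := irreducible_block irr _ (mem_sumset0 X) E'; lia.
Qed.

(** Otherwise the first j >= 2 terms could be replaced by [x] and fewer than j copies of [a]. *)
Lemma irreducible_psum_notin (a : nat) (X : {fset int}) (s : seq int) (j : nat)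
    (x : int) :
  in_interval 0 a X -> irreducible a X s -> (2 <= j <= size s)%N ->
  x \in X -> x < a%:Z -> (psum s j %% a%:Z)%Z != (x %% a%:Z)%Z.
Proof.
move=> Xa irr js xX xa; have x0 := Xa _ xX; have [sX _] := irr.
have j0 : (0 < j <= size s)%N by lia.
have := psum_bounds (irreducible_interior Xa irr) j0.
rewrite psum0 subr0 subn0 => jb.
have nE k : psum s j = x + a%:Z *+ k -> (k < j)%N -> False.
  move=> E kj; have E' : psum s j = psum s 0 + x + a%:Z *+ k.
    by rewrite psum0 add0r.
  have := irreducible_block irr _ (mem_sumset1 xX) E'; lia.
apply/eqP => /eqmod_shift[k] [] E; first by apply: (nE k) => //; nia.
have k0 : k = 0%N by nia.
by apply: (nE 0); rewrite ?k0 in E *; lia.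
Qed.

(* Neither [psum s 1] nor [psum t 1] is counted, since both lie in [X]. *)
Lemma residues_leq (a : nat) (X : {fset int}) (s t : seq int) (m n : nat) :
  in_interval 0 a X -> a%:Z \in X -> irreducible a X s -> irreducible a X t ->
  (0 < m <= size s)%N -> (0 < n <= size t)%N ->
  (forall i j, (2 <= i <= m)%N -> (2 <= j <= n)%N ->
     (psum s i %% a%:Z)%Z != (psum t j %% a%:Z)%Z) ->
  (#|` X| + m + n <= a + 3)%N.
Proof.
move=> Xa aX irrs irrt ms nt st.
have sa : {in s, forall x, 0 < x < a%:Z} by apply: irreducible_interior Xa irrs.
have a0 : 0 < a%:Z.
  have /sa/andP[] : nth 0 s 0 \in s by apply: mem_nth; case/andP: ms; apply: leq_trans.
  exact: lt_trans.
pose res u k := [seq (psum u i %% a%:Z)%Z | i <- iota 2 k.-1].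
have res_uniq u k : irreducible a X u -> (k <= size u)%N -> uniq (res u k).
  move=> irru ku; rewrite map_inj_in_uniq ?iota_uniq // => i j.
  rewrite !mem_iota => ik jk /eqP; case: (ltngtP i j) => // ij E.
    by have := @irreducible_psum_neq a X u i j Xa irru; rewrite E; lia.
  by have := @irreducible_psum_neq a X u j i Xa irru; rewrite eq_sym E; lia.
have XaP x : x \in (X `\ a%:Z)%fset -> x \in X /\ 0 <= x < a%:Z.
  by rewrite in_fsetD1 => /andP[xa xX]; have := Xa _ xX; split=> //; lia.
have res_notin u k x : irreducible a X u -> (k <= size u)%N ->
    x \in (X `\ a%:Z)%fset -> x \notin res u k.
  move=> irru ku /XaP[xX xa]; apply/mapP => -[i]; rewrite mem_iota => ik.
  have -> : x = (x %% a%:Z)%Z by rewrite modz_small.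
  move/esym/eqP; apply/negP; apply: (irreducible_psum_notin Xa irru _ xX); lia.
(* Pigeonhole in [0, a): |X| - 1 elements other than [a], then m - 1 and n - 1 residues. *)
have := @size_uniq_interval a (enum_fset (X `\ a%:Z)%fset ++ res s m ++ res t n).
rewrite !size_cat !size_map !size_iota.
have -> : size (enum_fset (X `\ a%:Z)%fset) = #|` X|.-1.
  by rewrite -/(#|` (X `\ a%:Z)|)%fset (cardfsD1 a%:Z X) aX.
suff H : uniq (enum_fset (X `\ a%:Z)%fset ++ res s m ++ res t n) /\
    {in enum_fset (X `\ a%:Z)%fset ++ res s m ++ res t n,
      forall x, 0 <= x < a%:Z}.
  by case: H => H1 H2 /(_ H1 H2); lia.
split.
  rewrite !cat_uniq fset_uniq !res_uniq //=; try lia.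
  apply/and3P; split=> //.
    apply/hasPn => x; rewrite mem_cat => xr; apply/negP => xX.
    by case/orP: xr; apply/negP; apply: res_notin => //; lia.
  apply/hasPn => x /mapP[j]; rewrite mem_iota => jn ->.
  apply/mapP => -[i]; rewrite mem_iota => im /esym/eqP; apply/negP.
  by apply: st; lia.
move=> x; rewrite !mem_cat => /or3P[/XaP[]//|/mapP[i _ ->]|/mapP[i _ ->]];
  by rewrite modz_ge0 ?ltz_pmod; lia.
Qed.

(** If both memberships fail, every representation of [p] by h+2 terms is irreducible, and its
    partial sums have too many residues. *)
Lemma sumset_long (a h : nat) (X : {fset int}) (p : int) :
  in_interval 0 a X -> 0 \in X -> a%:Z \in X -> (a < h + #|` X|)%N ->
  p \in sumset h.+2 X -> p \in sumset h.+1 X \/ p - a%:Z \in sumset h.+1 X.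
Proof.
move=> Xa X0 aX ah /sumset_seqP[s [sz sX pE]].
have [|p1] := boolP (p \in sumset h.+1 X); first by left.
have [|p2] := boolP (p - a%:Z \in sumset h.+1 X); first by right.
exfalso; have irr : irreducible a X s.
  split=> // q [|k] y yq; rewrite -pE sz => E qk.
    have [//|qh] := eqVneq q h.+2; case/negP: p1.
    by rewrite E addr0; apply: sumset_le yq => //; lia.
  case/negP: p2; rewrite E mulrSr addrA addrK.
  by apply: (@sumset_le _ (q + k)); [| lia |apply/sumsetD/sumset_mulrn].
(* With n = 1 the second copy of [s] contributes no residue. *)
have := @residues_leq a X s s h.+2 1 Xa aX irr irr; rewrite sz.
have st i j : (2 <= i <= h.+2)%N -> (2 <= j <= 1)%N ->
  (psum s i %% a%:Z)%Z != (psum s j %% a%:Z)%Z by lia.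
by move/(_ _ _ st); lia.
Qed.

(** * Means of initial segments of sorted sequences, with denominators cleared *)

Lemma allrel_sum_le (s t : seq int) :
  allrel <=%R s t ->
  (size t)%:Z * \sum_(x <- s) x <= (size s)%:Z * \sum_(y <- t) y.
Proof.
have one x : all (fun y => x <= y) t -> (size t)%:Z * x <= \sum_(y <- t) y.
  elim: t => [|y t IH]; rewrite ?big_nil ?big_cons /= ?mul0r // => /andP[xy /IH].
  by set S := \sum_(_ <- _) _; nia.
elim: s => [|x s IH]; rewrite ?big_nil ?big_cons /= ?mulr0 ?mul0r //.
rewrite allrel_consl => /andP[/one + /IH].
by set S := \sum_(_ <- _) _; set T := \sum_(_ <- _) _; nia.
Qed.

Lemma sorted_take_drop (T : eqType) (r : rel T) (s : seq T) (i : nat) :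
  transitive r -> sorted r s -> allrel r (take i s) (drop i s).
Proof.
move=> tr; rewrite sorted_pairwise // -{1}(cat_take_drop i s) pairwise_cat.
by case/and3P.
Qed.

Lemma sorted_psum_le (s : seq int) (i : nat) :
  sorted <=%R s -> (i <= size s)%N ->
  psum s i * (size s)%:Z <= i%:Z * \sum_(x <- s) x.
Proof.
move=> /(sorted_take_drop i le_trans)/allrel_sum_le.
rewrite size_drop size_take_min -/(psum s i) => H ile.
move: H; rewrite (minn_idPl ile) (sum_psum s i) -subzn //.
by set T := \sum_(_ <- _) _; nia.
Qed.

Lemma sorted_psum_ge (s : seq int) (i : nat) :
  sorted >=%R s -> (i <= size s)%N ->
  i%:Z * \sum_(x <- s) x <= psum s i * (size s)%:Z.
Proof.
move=> /(sorted_take_drop i ge_trans); rewrite allrelC => /allrel_sum_le.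
rewrite size_drop size_take_min -/(psum s i) => H ile.
move: H; rewrite (minn_idPl ile) (sum_psum s i) -subzn //.
by set T := \sum_(_ <- _) _; nia.
Qed.

Lemma sumset_sorted_seq (r : rel int) (h : nat) (A : {fset int}) (x : int) :
  total r -> x \in sumset h A ->
  exists s : seq int,
    [/\ size s = h, {subset s <= A}, x = \sum_(y <- s) y & sorted r s].
Proof.
move=> tot /sumset_seqP[s [sz sA ->]]; exists (sort r s); split.
- by rewrite size_sort.
- by move=> y; rewrite mem_sort => /sA.
- by apply: perm_big; rewrite perm_sym perm_sort.
- exact: sort_sorted.
Qed.

(* The monotonicity of [s] and [t] enters through averages: the mean of [t]
   exceeds that of [s], so [psum t j / j > psum s i / i].  This excludes
   [psum s i = psum t j + k a]; in the case [psum t j = psum s i + k a],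
   exchanging initial segments would put the sum of [s] plus [l a] in hX. *)
Lemma cross_psum_neq (a h l : nat) (X : {fset int}) (s t : seq int) (i j : nat) :
  in_interval 0 a X -> 0 \in X -> a%:Z \in X ->
  irreducible a X s -> irreducible a X t -> sorted <=%R s -> sorted >=%R t ->
  (size s + l = h.+1)%N -> (size t <= h.+1)%N -> (l < size t)%N ->
  \sum_(x <- t) x = \sum_(x <- s) x + a%:Z *+ l.+1 ->
  \sum_(x <- s) x + a%:Z *+ l \notin sumset h X ->
  (2 <= i <= size s)%N -> (2 <= j <= l.+1)%N ->
  (psum s i %% a%:Z)%Z != (psum t j %% a%:Z)%Z.
Proof.
move=> Xa X0 aX irrs irrt ss st sl th lt E pN /andP[i2 ile] /andP[j2 jle].
have [sX _] := irrs; have [tX _] := irrt.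
have sa := irreducible_interior Xa irrs; have ta := irreducible_interior Xa irrt.
have jt : (j <= size t)%N by lia.
have ib : (0 < i <= size s)%N by lia.
have jb : (0 < j <= size t)%N by lia.
have nb : (0 < size s <= size s)%N by lia.
have := psum_bounds sa ib; have := psum_bounds ta jb; have := psum_bounds sa nb.
rewrite !psum0 !subr0 !subn0 {1 2}/psum take_size.
have := sorted_psum_le ss ile; have := sorted_psum_ge st jt; rewrite E.
have := mem_sumset0 X; have := psum_subset sX ile; have := psum_subset tX jt.
have := psum_drop i sX.
have brs q k y : y \in sumset q X -> psum s i = y + a%:Z *+ k ->
    (q + k <= i)%N -> q = i.
  move=> yX e; have e' : psum s i = psum s 0 + y + a%:Z *+ k by rewrite psum0 add0r.
  by have := irreducible_block irrs _ yX e'; rewrite subn0; apply.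
have brt q k y : y \in sumset q X -> psum t j = y + a%:Z *+ k ->
    (q + k <= j)%N -> q = j.
  move=> yX e; have e' : psum t j = psum t 0 + y + a%:Z *+ k by rewrite psum0 add0r.
  by have := irreducible_block irrt _ yX e'; rewrite subn0; apply.
move: pN brs brt; set S := \sum_(x <- s) x; set f := psum t j; set g := psum s i.
set n := size s; set m := size t => pN brs brt dX fX gX _ avg avf Sb fb gb.
have {avf avg} avgfg : j%:Z * g < i%:Z * f.
  rewrite -mulr_natr natz in avg; set S' := S + _ in avg.
  (* As m <= n + l and S <= a n, m S <= n S + l a n < n (S + (l+1) a). *)
  have SS' : m%:Z * S < n%:Z * S'.
    have : m%:Z * S <= (n%:Z + l%:Z) * S by apply: ler_wpM2r; lia.
    have : l%:Z * S <= l%:Z * (a%:Z * n%:Z) by apply: ler_wpM2l; lia.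
    rewrite /S'; have : 0 < n%:Z * a%:Z by apply: mulr_gt0; lia.
    nia.
  have mn0 : 0 < m%:Z * n%:Z by apply: mulr_gt0; lia.
  rewrite -(ltr_pM2l mn0).
  have e1 : j%:Z * m%:Z * (g * n%:Z) <= j%:Z * m%:Z * (i%:Z * S).
    by apply: ler_wpM2l => //; apply: mulr_ge0.
  have e2 : i%:Z * n%:Z * (j%:Z * S') <= i%:Z * n%:Z * (f * m%:Z).
    by apply: ler_wpM2l => //; apply: mulr_ge0.
  have e3 : i%:Z * j%:Z * (m%:Z * S) < i%:Z * j%:Z * (n%:Z * S').
    by rewrite ltr_pM2l //; apply: mulr_gt0; lia.
  lia.
apply/eqP => /eqmod_shift[k] [] e; rewrite -mulr_natr natz in e.
  have ak : 0 <= a%:Z * k%:Z by [].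
  have ij : (j < i)%N.
    rewrite ltnNge; apply/negP => ij.
    have : i%:Z * f <= j%:Z * f by apply: ler_wpM2r; lia.
    have : j%:Z * f <= j%:Z * g by apply: ler_wpM2l; lia.
    lia.
  (* Inserting g = f + a k into j g < i f gives j a k < (i - j) f < (i - j) a j. *)
  have jki : (j + k < i)%N.
    have : j%:Z * (a%:Z * k%:Z) < (i%:Z - j%:Z) * f by rewrite e in avgfg; lia.
    have : (i%:Z - j%:Z) * f < (i%:Z - j%:Z) * (a%:Z * j%:Z).
      by rewrite ltr_pM2l; lia.
    move=> u v; have {u v} := lt_trans v u.
    have -> : j%:Z * (a%:Z * k%:Z) = (j%:Z * a%:Z) * k%:Z by ring.
    have -> : (i%:Z - j%:Z) * (a%:Z * j%:Z) = (j%:Z * a%:Z) * (i%:Z - j%:Z) by ring.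
    by rewrite ltr_pM2l; [lia | apply: mulr_gt0; lia].
  have := brs j k f fX; rewrite -mulr_natr natz => /(_ e); lia.
have [ikj|jik] := leqP (i + k) j.
  have ij : i = j by apply: (brt i k g gX) => //; rewrite -mulr_natr natz.
  have k0 : k = 0%N by lia.
  by move: avgfg; rewrite e k0 ij mulr0 addr0 ltxx.
case/negP: pN.
have kl : (k <= l)%N.
  have : a%:Z * k%:Z < a%:Z * j%:Z by lia.
  by rewrite ltr_pM2l; nia.
(* The right-hand side uses j + (n - i) + (l - k) terms, at most h because j < i + k and n + l = h +
   1. *)
have -> : S + a%:Z *+ l = f + (S - g) + a%:Z *+ (l - k).
  by rewrite mulrnBr // e -(mulr_natr _ k) natz; ring.
apply: sumset_le X0 _ (sumsetD (sumsetD fX dX) (sumset_mulrn (l - k) aX)).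
by rewrite -/n; lia.
Qed.

(* Take [l] maximal with [p - l a] in (h+1-l)X and [m] minimal with [p + a] in
   mX.  The h+1-l terms of the first sum and the m > l+1 terms of the second
   yield h partial sums, distinct modulo [a] and not congruent to elements of
   [X], which is too many. *)
Lemma sumset_corner (a h : nat) (X : {fset int}) (p : int) :
  in_interval 0 a X -> 0 \in X -> a%:Z \in X -> (a.+1 < h + #|` X|)%N ->
  p \in sumset h.+1 X -> p + a%:Z \in sumset h.+1 X -> p \in sumset h X.
Proof.
move=> Xa X0 aX ah p1 pa1; apply/negPn/negP => pN.
pose P l := (l <= h.+1)%N && (p - a%:Z *+ l \in sumset (h.+1 - l) X).
have exP : exists l, P l by exists 0%N; rewrite /P subn0 subr0.
have boundP l : P l -> (l <= h.+1)%N by case/andP.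
case: (ex_maxnP exP boundP) => l /andP[lh lX] lmax.
have exQ : exists m, p + a%:Z \in sumset m X by exists h.+1.
case: (ex_minnP exQ) => m mX mmin.
have mh : (m <= h.+1)%N := mmin _ pa1.
have [s [sz sX sE ss]] := sumset_sorted_seq (@le_total _ _) lX.
have [t [tz tX tE st]] := sumset_sorted_seq ge_total mX.
have irrs : irreducible a X s.
  split=> // q k y yX; rewrite -sE sz => E qk.
  (* Maximality of [l] excludes k > 0; if k = 0, fewer terms would put [p] in hX. *)
  have /lmax : P (l + k)%N.
    apply/andP; split; first lia.
    rewrite mulrnDr opprD addrA E addrK; apply: sumset_le yX => //; lia.
  case: k E qk => [|k] E qk; last lia.
  move=> _; have [//|qh] := eqVneq q (h.+1 - l)%N; case/negP: pN.
  rewrite -(subrK (a%:Z *+ l) p) E addr0.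
  by apply: sumset_le X0 _ (sumsetD yX (sumset_mulrn l aX)); lia.
have irrt : irreducible a X t.
  (* Fewer terms contradict the minimality of [m]; a copy of [a] would cancel the one in p + a and
     put [p] in hX. *)
  split=> // q [|k] y yX; rewrite -tE tz => E qk.
    by have := mmin q; rewrite E addr0 => /(_ yX); lia.
  case/negP: pN; rewrite -(addrK a%:Z p) E mulrSr addrA addrK.
  by apply: sumset_le X0 _ (sumsetD yX (sumset_mulrn k aX)); lia.
have E : \sum_(x <- t) x = \sum_(x <- s) x + a%:Z *+ l.+1.
  by rewrite -tE -sE mulrS; ring.
have S0 : 0 <= \sum_(x <- s) x.
  by rewrite big_seq; apply: sumr_ge0 => x /sX/Xa/andP[].
(* The sum of [t] is at least (l+1) a, but below m a since each term is below [a]. *)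
have lm : (l.+1 < m)%N.
  have al : 0 <= a%:Z *+ l by rewrite mulrn_wge0.
  have [m0|m0] := posnP m.
    case/negP: pN; suff -> : p = 0 by apply: sumset_le X0 _ (mem_sumset0 X).
    have : p + a%:Z = 0 by rewrite tE (size0nil (etrans tz m0)) big_nil.
    by move: sE; set S := \sum_(_ <- _) _ in S0 *; lia.
  have := sum_open_interval (irreducible_interior Xa irrt).
  by rewrite E tz -mulr_natr natz => /(_ m0); nia.
have pE : \sum_(x <- s) x + a%:Z *+ l = p by rewrite -sE subrK.
have := residues_leq (m := size s) (n := l.+1) Xa aX irrs irrt.
rewrite sz tz leqnn subn_gt0 => /(_ _ (ltnW lm)) H.
suff : (#|` X| + (h.+1 - l) + l.+1 <= a + 3)%N by lia.
apply: H; first lia.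
move=> i j ib jb; apply: (cross_psum_neq (l := l) (h := h) Xa X0 aX) => //.
all: rewrite ?sz ?tz ?pE //; lia.
Qed.

(** * Translates, and the affine growth of |hX| *)

Definition translate (c : int) (A : {fset int}) : {fset int} :=
  [fset (x + c)%R | x in A]%fset.

Lemma card_translate (A : {fset int}) (c : int) :
  #|` translate c A| = #|` A|.
Proof. by rewrite card_imfset //; apply: addIr. Qed.

Lemma mem_translate (A : {fset int}) (c x : int) :
  (x \in translate c A) = (x - c \in A).
Proof.
apply/imfsetP/idP => /= [[y yA ->]|xA]; first by rewrite addrK.
by exists (x - c) => //; rewrite subrK.
Qed.

(** (h+2)X is the union of (h+1)X and its translate by [a], and these meet in hX + a;
    inclusion-exclusion gives the count. *)
Lemma card_sumset_linear (a h : nat) (X : {fset int}) :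
  in_interval 0 a X -> 0 \in X -> a%:Z \in X -> (a.+1 < h + #|` X|)%N ->
  (#|` sumset h.+2 X| + #|` sumset h X| = (#|` sumset h.+1 X|).*2)%N.
Proof.
move=> Xa X0 aX ah; pose Y := translate a%:Z (sumset h.+1 X).
have addX n p : p \in sumset n X -> p + a%:Z \in sumset n.+1 X.
  by move=> pX; rewrite -addn1; apply/sumsetD/mem_sumset1.
have -> : sumset h.+2 X = (sumset h.+1 X `|` Y)%fset.
  apply/fsetP => p; rewrite in_fsetU mem_translate; apply/idP/orP.
    by move/(sumset_long Xa X0 aX); apply; lia.
  by case=> [|/addX]; [apply: sumset_le | rewrite subrK].
have <- : #|` sumset h.+1 X `&` Y|%fset = #|` sumset h X|.
  rewrite -[RHS](card_translate _ a%:Z); congr #|` _|; apply/fsetP => p.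
  rewrite in_fsetI !mem_translate; apply/andP/idP => [[p1 p2]|pX].
    by apply: (sumset_corner Xa X0 aX ah); rewrite ?subrK.
  by split; [rewrite -(subrK a%:Z p); apply: addX | apply: sumset_le pX].
by rewrite cardfsUI card_translate addnn.
Qed.

Lemma sumset_translate (A : {fset int}) (c : int) (h : nat) :
  sumset h (translate c A) = translate (c *+ h) (sumset h A).
Proof.
have sub B d y : y \in sumset h B ->
    y + d *+ h \in sumset h (translate d B).
  case/sumsetP=> a aB ->; apply/sumsetP; exists (fun i => a i + d).
    by move=> i; rewrite mem_translate addrK.
  by rewrite big_split /= sumr_const card_ord.
apply/fsetP => x; rewrite mem_translate; apply/idP/idP => [/(sub _ (- c))|/sub].
  rewrite mulNrn; congr (_ \in sumset h _); apply/fsetP => y.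
  by rewrite !mem_translate opprK addrK.
by move/(_ c); rewrite subrK.
Qed.

Lemma interval_extrema (N : nat) (A : {fset int}) :
  in_interval 0 N A -> A != fset0 ->
  exists c d : nat, [/\ c%:Z \in A, d%:Z \in A, (d <= N)%N &
                        in_interval c d A].
Proof.
move=> AN /fset0Pn[x xA].
have ex : exists n : nat, n%:Z \in A.
  by exists `|x|%N; have := AN _ xA; case: x xA => //= n; rewrite lerNr.
have bd (n : nat) : n%:Z \in A -> (n <= N)%N by move/AN.
case: (ex_minnP ex) => c cA cmin; case: (ex_maxnP ex bd) => d dA dmax.
exists c, d; split=> // [|y yA]; first exact: bd.
case: y yA (AN _ yA) => [n nA _|n _]; last by lia.
by rewrite !lez_nat cmin ?dmax.
Qed.

(** Once the minimum is moved to 0, the maximum [a] is at most h+2, so four elements ensure a + 1 <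
    h + |A|. *)
Lemma card_sumset_linear_interval (h : nat) (A : {fset int}) :
  in_interval 0 h.+2 A -> (4 <= #|` A|)%N ->
  (#|` sumset h.+2 A| + #|` sumset h A| = (#|` sumset h.+1 A|).*2)%N.
Proof.
move=> AN A4; have A0 : A != fset0 by rewrite -cardfs_gt0; lia.
have [c [d [cA dA dN Acd]]] := interval_extrema AN A0.
have := @card_sumset_linear (d - c) h (translate (- c%:Z) A).
have cd : (c <= d)%N by have := Acd _ cA; lia.
rewrite !sumset_translate !card_translate; apply.
- by move=> x; rewrite mem_translate opprK => /Acd; lia.
- by rewrite mem_translate opprK add0r.
- by rewrite mem_translate opprK -subzn // subrK.
- lia.
Qed.

(** * The size of 2A and the lower bound *)

Lemma sumset2P (A : {fset int}) (x : int) :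
  reflect (exists y z, [/\ y \in A, z \in A & x = y + z]) (x \in sumset 2 A).
Proof.
apply: (iffP (sumsetP _ _ _)) => [[a aA ->]|[y [z [yA zA ->]]]].
  by exists (a ord0), (a ord_max); split=> //; rewrite big_ord_recl big_ord1;
    congr (_ + a _); apply: val_inj.
exists (fun i : 'I_2 => if i == ord0 then y else z); first by move=> i; case: ifP.
by rewrite big_ord_recl big_ord1.
Qed.

(** Adjoining a point [x] to [A] creates at most |A| + 1 new sums, those with a summand [x]. *)
Lemma card_sumset2_le (A : {fset int}) : (#|` sumset 2 A| <= 'C(#|` A|.+1, 2))%N.
Proof.
have [n] := ubnP #|` A|; elim: n A => // n IHn A An.
have [->|[x xA]] := fset_0Vmem A.
  rewrite cardfs0 leqn0 cardfs_eq0; apply/eqP/fsetP => x; rewrite in_fset0.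
  by apply/sumset2P => -[y [z []]].
rewrite -(fsetD1K xA) in An *; move: (A `\ x)%fset (fsetD11 x A) An => {xA}A xA.
rewrite cardfsU1 xA add1n ltnS => /IHn IH; rewrite binS bin1.
have /fsubset_leq_card : (sumset 2 (x |` A)
    `<=` sumset 2 A `|` translate x (x |` A))%fset.
  apply/fsubsetP => _ /sumset2P[y [z [yA zA ->]]].
  rewrite in_fsetU mem_translate; apply/orP.
  have [->|yx] := eqVneq y x; first by right; rewrite addrAC subrr add0r.
  have [->|zx] := eqVneq z x; first by right; rewrite addrK.
  by left; apply/sumset2P; exists y, z; move: yA zA;
    rewrite !in_fset1U (negPf yx) (negPf zx).
move/leq_trans; apply; rewrite cardfsU card_translate.
by apply: leq_trans (leq_subr _ _) _; rewrite cardfsU1 xA leq_add2r.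
Qed.

(** The translates of [A] by its minimum and by its maximum lie in 2A and share at most one
    point. *)
Lemma card_sumset2_ge (N : nat) (A : {fset int}) :
  in_interval 0 N A -> ((#|` A|).*2 <= (#|` sumset 2 A|).+1)%N.
Proof.
move=> AN; have [->|A0] := eqVneq A fset0; first by rewrite cardfs0.
have [c [d [cA dA _ Acd]]] := interval_extrema AN A0.
pose L := translate c%:Z A; pose R := translate d%:Z A.
have /fsubset_leq_card LR : (L `|` R `<=` sumset 2 A)%fset.
  apply/fsubsetP => x; rewrite in_fsetU !mem_translate => /orP[] xA;
    apply/sumset2P.
    by exists (x - c%:Z), c%:Z; rewrite subrK.
  by exists (x - d%:Z), d%:Z; rewrite subrK.
have LR1 : (#|` L `&` R| <= 1)%fset%N.
  rewrite -(cardfs1 (c%:Z + d%:Z)); apply/fsubset_leq_card/fsubsetP => x.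
  rewrite in_fsetI !mem_translate in_fset1 => /andP[/Acd + /Acd]; lia.
rewrite -addnn -{1}(card_translate A c) -(card_translate A d) -cardfsUI.
rewrite -(addn1 #|` sumset 2 A|).
exact: leq_add.
Qed.

Lemma all_signs_realized_gt (H N : nat) :
  (3 <= H)%N -> all_signs_realized H N -> (H < N)%N.
Proof.
move=> H3 /(_ odd)[A [B [AN BN AB]]]; rewrite ltnNge; apply/negP => NH.
have widen X : in_interval 0 N X -> in_interval 0 (H - 2).+2 X.
  by move=> XN x /XN; lia.
have sumset1 X : #|` sumset 1 X| = #|` X|.
  congr #|` _|; apply/fsetP => x; apply/idP/idP => [|/mem_sumset1 //].
  by case/sumsetP=> a aX ->; rewrite big_ord1.
have AB1 : (#|` B| < #|` A|)%N.
  have H1 : (1 <= 1 <= H)%N by lia.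
  by have := AB _ H1; rewrite /has_sign /= !sumset1 subr_gt0.
have AB2 : (#|` sumset 2 A| < #|` sumset 2 B|)%N.
  have H2 : (1 <= 2 <= H)%N by lia.
  by have := AB _ H2; rewrite /has_sign /= subr_lt0.
(* If |B| <= 3, then |2B| <= 2|B| < 2|A| - 1 <= |2A|, against the sign at 2. *)
have B4 : (4 <= #|` B|)%N.
  rewrite leqNgt; apply/negP => B4.
  have b2 : ('C(#|` B|.+1, 2) <= (#|` B|).*2)%N.
    by case: #|` B| B4 => [|[|[|[|]]]].
  have := leq_trans AB2 (leq_trans (card_sumset2_le B) b2).
  have := card_sumset2_ge AN.
  by move: #|` sumset 2 A| #|` A| #|` B| AB1; lia.
have A4 : (4 <= #|` A|)%N by apply: ltnW (leq_ltn_trans B4 AB1).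
have := card_sumset_linear_interval (widen _ AN) A4.
have := card_sumset_linear_interval (widen _ BN) B4.
have H0 : (1 <= H - 2 <= H)%N by lia.
have H1 : (1 <= (H - 2).+1 <= H)%N by lia.
have H2 : (1 <= (H - 2).+2 <= H)%N by lia.
(* The value of |hA| - |hB| at H-1 is the average of those at H-2 and H, which share the opposite
   sign. *)
have := AB _ H0; have := AB _ H1; have := AB _ H2; rewrite /has_sign /= negbK.
move: (#|` sumset _ _|) (#|` sumset _ _|) (#|` sumset _ _|) => a b c.
move: (#|` sumset _ _|) (#|` sumset _ _|) (#|` sumset _ _|) => a' b' c'.
by case: (odd _) => /=; lia.
Qed.

(** * The ladder and its sumsets *)

Definition rung (h j d t : nat) : bool :=
  [|| t < h, d <= t < d + h | (j.+1).*2 <= t < (j.+1).*2 + h]%N.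

(* The sumset of multiplicity [h]; the set itself is the case [h = 1].  The
   elements from 3 H^2 to 6 H^2 form H windows of length 3 H, and the j-th window
   starts with the j-th thickened triple. *)
Definition in_ladder (H : nat) (d : nat -> nat) (h n : nat) : bool :=
  let j := ((n - 3 * H ^ 2) %/ (3 * H))%N in
  let t := ((n - 3 * H ^ 2) %% (3 * H))%N in
  [|| n <= h, 6 * H ^ 2 <= n | (3 * H ^ 2 <= n) && rung h j (d j) t]%N.

(** [in_ladder] holds for all n >= 6 H^2; the cutoff 12 H^2 h is the largest sum of h elements. *)
Definition ladder (H : nat) (d : nat -> nat) (h : nat) : {fset int} :=
  [fset x in [seq n%:Z | n <- iota 0 (12 * H ^ 2 * h).+1 & in_ladder H d h n]]%fset.

Lemma mem_ladder (H : nat) (d : nat -> nat) (h : nat) (x : int) :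
  reflect (exists n : nat, [/\ x = n%:Z, (n <= 12 * H ^ 2 * h)%N
                             & in_ladder H d h n])
          (x \in ladder H d h).
Proof.
rewrite in_fset; apply: (iffP mapP) => [[n]|[n [-> nle nL]]].
  by rewrite mem_filter mem_iota => /andP[nL nle] ->; exists n.
by exists n; rewrite // mem_filter nL mem_iota.
Qed.

Lemma card_ladder (H : nat) (d : nat -> nat) (h : nat) :
  #|` ladder H d h| = count (in_ladder H d h) (iota 0 (12 * H ^ 2 * h).+1).
Proof.
rewrite card_fseq undup_id ?size_map ?size_filter //.
by rewrite map_inj_uniq ?filter_uniq ?iota_uniq // => m n [].
Qed.

Lemma in_ladder_rung (H : nat) (d : nat -> nat) (h j t : nat) :
  (h <= H)%N -> (j < H)%N -> (t < 3 * H)%N ->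
  in_ladder H d h (3 * H ^ 2 + j * (3 * H) + t) = rung h j (d j) t.
Proof.
move=> hH jH tH; rewrite /in_ladder -addnA addKn leq_addr.
have H0 : (0 < 3 * H)%N by lia.
rewrite divnMDl // modnMDl divn_small // addn0 modn_small //=.
have -> : (3 * H ^ 2 + (j * (3 * H) + t) <= h)%N = false by nia.
by have -> : (6 * H ^ 2 <= 3 * H ^ 2 + (j * (3 * H) + t))%N = false by nia.
Qed.

(** Quotient and remainder recover j and t, because 2j + 2 + h <= 3H keeps a thickened triple inside
    its window. *)
Lemma in_ladderP (H : nat) (d : nat -> nat) (h n : nat) :
  (0 < h <= H)%N -> (forall j, d j <= j.+1)%N ->
  in_ladder H d h n <->
  [\/ (n <= h)%N, (6 * H ^ 2 <= n)%N |
      exists j t : nat, [/\ (j < H)%N, rung h j (d j) t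
                          & n = (3 * H ^ 2 + j * (3 * H) + t)%N]].
Proof.
move=> /andP[h0 hH] dj; split=> [|[nh|nH|[j [t [jH r ->]]]]].
- have [?|nh] := leqP n h; first by constructor 1.
  have [?|nH] := leqP (6 * H ^ 2) n; first by constructor 2.
  rewrite /in_ladder leqNgt nh leqNgt nH /= => /andP[Hn r].
  constructor 3; exists ((n - 3 * H ^ 2) %/ (3 * H))%N.
  exists ((n - 3 * H ^ 2) %% (3 * H))%N; split=> //.
    by rewrite ltn_divLR; [nia | lia].
  by rewrite -addnA -divn_eq subnKC.
- by rewrite /in_ladder nh.
- by rewrite /in_ladder nH orbT.
- by rewrite in_ladder_rung //; move: r (dj j); rewrite /rung; lia.
Qed.

(** Below 6 H^2 at most one summand comes from a triple, as each such element is at least 3 H^2; the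
    others are 0 or 1 and only thicken it. *)
Lemma sumset_ladder_sub (H : nat) (d : nat -> nat) (h : nat) (x : int) :
  (h < H)%N -> (forall j, d j <= j.+1)%N ->
  x \in sumset h.+1 (ladder H d 1) -> x \in ladder H d h.+1.
Proof.
move=> + dj; elim: h x => [|h IH] x hH.
  by case/sumsetP=> a aL ->; rewrite big_ord1.
case/sumsetP=> a aL ->; rewrite big_ord_recl.
have /IH : \sum_(i < h.+1) a (lift ord0 i) \in sumset h.+1 (ladder H d 1).
  by apply/sumsetP; exists (fun i => a (lift ord0 i)).
move=> /(_ (ltnW hH)) /mem_ladder[y [-> yle yL]].
have /mem_ladder[n [-> nle nL]] := aL ord0.
apply/mem_ladder; exists (n + y)%N; split=> //; first by lia.
move: nL yL; rewrite !in_ladderP //; try lia.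
move=> nL yL; have [?|nyH] := leqP (6 * H ^ 2) (n + y); first by constructor 2.
case: nL => [nL|nL|[i [t [iH r nE]]]]; [|lia|].
  case: yL => [yL|yL|[j [u [jH r yE]]]]; [by constructor 1; lia|lia|].
  constructor 3; exists j, (n + u)%N; split=> //; last by lia.
  by move: r; rewrite /rung; lia.
case: yL => [yL|yL|[j [u [jH _ yE]]]]; [|lia|lia].
constructor 3; exists i, (t + y)%N; split=> //; last by lia.
by move: r; rewrite /rung; lia.
Qed.

(** Zeros and ones fill the bottom and thicken the triples; sums from [6 H^2, 12 H^2], padded by
    zeros, fill the top. *)
Lemma ladder_sub_sumset (H : nat) (d : nat -> nat) (h : nat) (x : int) :
  (h < H)%N -> (forall j, d j <= j.+1)%N ->
  x \in ladder H d h.+1 -> x \in sumset h.+1 (ladder H d 1).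
Proof.
move=> hH dj; have H1 : (0 < 1 <= H)%N by lia.
have mem n : (n <= 12 * H ^ 2)%N -> in_ladder H d 1 n -> n%:Z \in ladder H d 1.
  by move=> nH nL; apply/mem_ladder; exists n; rewrite muln1.
have A0 : 0 \in ladder H d 1 by apply: (mem 0%N).
have low k n : (n <= k)%N -> n%:Z \in sumset k (ladder H d 1).
  move=> nk; apply: sumset_le A0 nk _; rewrite -natz.
  by apply: sumset_mulrn; apply: (mem 1%N); rewrite // muln_gt0 expn_gt0; lia.
case/mem_ladder=> n [-> nle]; rewrite in_ladderP; [|lia|done].
case=> [nh|nH|[j [t [jH r nE]]]]; first exact: low.
  have high k : (6 * H ^ 2 <= k <= 12 * H ^ 2)%N -> k%:Z \in ladder H d 1.
    case/andP=> k6 k12; apply: mem => //; apply/in_ladderP => //.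
    by constructor 2.
  elim: h {hH} n nle nH => [|h IH] n nle nH.
    by apply/mem_sumset1/high; lia.
  have [nh|hn] := leqP n (12 * H ^ 2 * h.+1).
    by apply: sumset_le A0 _ (IH _ nh nH).
  (* Removing 12 H^2 could leave less than 6 H^2 when the excess is small; then 6 H^2 is removed
     instead. *)
  have [nh|nh] := leqP n (12 * H ^ 2 * h.+1 + 6 * H ^ 2).
    rewrite -(@subnK (6 * H ^ 2) n) // PoszD -(addn1 h.+1).
    by apply: sumsetD; [apply: IH; nia | apply/mem_sumset1/high; lia].
  rewrite -(@subnK (12 * H ^ 2) n) ?PoszD -?(addn1 h.+1); last by nia.
  by apply: sumsetD; [apply: IH; nia | apply/mem_sumset1/high; lia].
have [s [u [uh tE sL]]] : exists s u : nat,
    [/\ (u <= h)%N, t = (s + u)%N & [|| s == 0, s == d j | s == j.+1.*2]%N].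
  move: r; rewrite /rung => /or3P[tr|tr|tr].
  - by exists 0%N, t.
  - by exists (d j), (t - d j)%N; rewrite eqxx orbT; split=> //; lia.
  - by exists j.+1.*2, (t - j.+1.*2)%N; rewrite eqxx !orbT; split=> //; lia.
rewrite nE tE addnA PoszD -(add1n h); apply: sumsetD (low _ _ uh).
apply/mem_sumset1/mem; first by have := dj j; nia.
rewrite in_ladder_rung //; last by have := dj j; lia.
by rewrite /rung; lia.
Qed.

Lemma sumset_ladder (H : nat) (d : nat -> nat) (h : nat) :
  (0 < h <= H)%N -> (forall j, d j <= j.+1)%N ->
  sumset h (ladder H d 1) = ladder H d h.
Proof.
case: h => // h hH dj; apply/fsetP => x; apply/idP/idP.
  exact: sumset_ladder_sub.
exact: ladder_sub_sumset.
Qed.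

(** * Counting the ladder and realizing the signs *)

Lemma count_interval (a b n : nat) :
  count (fun t => a <= t < b)%N (iota 0 n) = (minn b n - a)%N.
Proof.
elim: n => [|n IH]; first by rewrite minn0.
by rewrite -addn1 iotaD count_cat IH /= add0n; lia.
Qed.

Lemma count_rung (h j d n : nat) :
  (d <= (j.+1).*2)%N -> ((j.+1).*2 + h <= n)%N ->
  count (rung h j d) (iota 0 n) = (h + minn h d + minn h ((j.+1).*2 - d))%N.
Proof.
move=> dj hn.
(* The three intervals are made disjoint by cutting from each its overlap with the previous one. *)
have -> s : count (rung h j d) s = (count (fun t => 0 <= t < h) s
    + count (fun t => maxn h d <= t < d + h) s
    + count (fun t => maxn (d + h) (j.+1).*2 <= t < (j.+1).*2 + h) s)%N.
  elim: s => //= t s ->; rewrite /rung; lia.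
by rewrite !count_interval; lia.
Qed.

Lemma count_iota_mul (p : pred nat) (m k w : nat) :
  count p (iota m (k * w))
    = (\sum_(j < k) count (fun t => p (m + j * w + t)) (iota 0 w))%N.
Proof.
elim: k => [|k IH]; first by rewrite big_ord0.
rewrite mulSnr iotaD count_cat IH big_ord_recr /=; congr (_ + _)%N.
by rewrite -[X in iota X w]addn0 iotaDl count_map.
Qed.

Lemma card_ladder_split (H : nat) (d : nat -> nat) (h : nat) :
  (0 < h <= H)%N -> (forall j, d j <= j.+1)%N ->
  (#|` ladder H d h|
    = (h.+1 + (12 * H ^ 2 * h).+1 - 6 * H ^ 2)
      + \sum_(j < H) (h + minn h (d j) + minn h ((j.+1).*2 - d j)))%N.
Proof.
move=> hH dj; rewrite card_ladder.
(* The range is cut at 3 H^2 and 6 H^2 into bottom, windows and top. *)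
have {1}-> : (12 * H ^ 2 * h).+1 = (3 * H ^ 2 + H * (3 * H)
    + ((12 * H ^ 2 * h).+1 - 6 * H ^ 2))%N by nia.
rewrite (iotaD 0 (3 * H ^ 2 + _)) (iotaD 0 (3 * H ^ 2)) !count_cat !add0n (count_iota_mul _ (3 * H ^ 2)).
have -> : count (in_ladder H d h) (iota 0 (3 * H ^ 2)) = h.+1.
  rewrite (@eq_in_count _ _ (fun t => 0 <= t < h.+1)%N) ?count_interval; first nia.
  by move=> n; rewrite mem_iota /in_ladder => nH /=; nia.
have -> : count (in_ladder H d h) (iota (3 * H ^ 2 + H * (3 * H))
    ((12 * H ^ 2 * h).+1 - 6 * H ^ 2)) = ((12 * H ^ 2 * h).+1 - 6 * H ^ 2)%N.
  rewrite (@eq_in_count _ _ predT) ?count_predT ?size_iota //.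
  by move=> n; rewrite mem_iota /in_ladder => nH /=; nia.
have -> : (\sum_(j < H)
    count (fun t => in_ladder H d h (3 * H ^ 2 + j * (3 * H) + t)) (iota 0 (3 * H))
  = \sum_(j < H) (h + minn h (d j) + minn h ((j.+1).*2 - d j)))%N.
  apply: eq_bigr => j _; rewrite -(@count_rung _ _ _ (3 * H)).
  - apply: eq_in_count => t; rewrite mem_iota => tH.
    by apply: in_ladder_rung => //; lia.
  - by have := dj j; lia.
  - by have := ltn_ord j; lia.
set S := (\sum_(_ < _) _)%N; nia.
Qed.

Lemma all_signs_realized_ladder (H : nat) : all_signs_realized H (12 * H ^ 2).
Proof.
(* Of the two sets, the one that must win at h = j+1 gets the middle element j+1 instead of j, which
   gains one element there. *)
move=> eps; pose d (e : bool) j := (j + (eps j.+1 == e))%N.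
have dj e j : (d e j <= j.+1)%N by rewrite /d; case: eqP; lia.
exists (ladder H (d true) 1), (ladder H (d false) 1); split.
- by move=> _ /mem_ladder[n [-> nle _]]; lia.
- by move=> _ /mem_ladder[n [-> nle _]]; lia.
move=> h hH; rewrite !sumset_ladder // !card_ladder_split //.
have hi : (h.-1 < H)%N by lia.
pose F e j := (h + minn h (d e j) + minn h ((j.+1).*2 - d e j))%N.
(* For j other than h-1 the count does not depend on [e], so the remaining sum is the same for both
   sets. *)
have FE e : (\sum_(j < H) F e j
    = F e h.-1 + \sum_(j < H | j != Ordinal hi) F true j)%N.
  rewrite (bigD1 (Ordinal hi)) //=; congr (_ + _)%N; apply: eq_bigr => j.
  by rewrite -val_eqE /= /F /d => jh; case: (eps _) e => -[] /=; lia.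
rewrite !FE /F /d (prednK _) /has_sign; last by lia.
by case: (eps h) => /=; lia.
Qed.
Theorem theorem1p7 (R : realType) :
  exists C : R, 0 < C /\
    forall H : nat, (3 <= H)%N ->
      exists nu : nat,
        [/\ is_nu H nu, (H + 1 <= nu)%N & nu%:R <= C * H%:R ^+ 3].
Proof.
(* 12 H^2 <= 4 H^3 as soon as H >= 3. *)
exists 4; split=> // H H3.
pose P N := `[< all_signs_realized H N >].
have exP : exists N, P N.
  by exists (12 * H ^ 2)%N; apply/asboolP; apply: all_signs_realized_ladder.
case: (ex_minnP exP) => nu /asboolP nuH numin; exists nu; split.
- by split=> // M MH; apply: numin; apply/asboolP.
- by rewrite addn1; apply: all_signs_realized_gt.
have /numin nuN : P (12 * H ^ 2)%N.
  by apply/asboolP; apply: all_signs_realized_ladder.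
have : (nu <= 4 * H ^ 3)%N by apply: leq_trans nuN _; nia.
by rewrite -(ler_nat R) natrM natrX.
Qed.
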